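(* Let $(E,\|\cdot\|_E)$ be a finite-dimensional real normed space and $G$ a discrete subgroup of $E$. Let $T=T(\Sigma,\tau,\theta)$ be a $k$-dimensional rectifiable $G$-current in $\mathbb{R}^d$ which admits a smooth calibration $\omega$. Then $T$ is a minimizer for the mass among the $k$-dimensional normal $E$-currents in $\mathbb{R}^d$ with boundary $\partial T$; that is, $\mathbb{M}(T)\le\mathbb{M}(T')$ for every $k$-dimensional normal $E$-current $T'$ with $\partial T'=\partial T$.
   Context: **Forms.** $E^*$ is the dual of $E$ with the dual norm $\|f\|_{E^*}=\sup_{\|v\|_E\le1}\langle f;v\rangle$. An $E^*$-valued $k$-covector in $\mathbb{R}^d$ is a map $\omega:\Lambda_k(\mathbb{R}^d)\times E\to\mathbb{R}$, linear in each variable; write $\langle\omega;\tau,v\rangle=\omega(\tau,v)$. Its comass is $\|\omega\|=\sup\{\|\omega(\tau,\cdot)\|_{E^*}:|\tau|\le1,\ \tau\text{ simple}\}$. The space of these is $\Lambda^k_E(\mathbb{R}^d)$. An $E^*$-valued $k$-form is a map $\omega:\mathbb{R}^d\to\Lambda^k_E(\mathbb{R}^d)$, with comass $\|\omega\|=\sup_x\|\omega(x)\|$. Given a basis $v_1,\dots,v_m$ of $E$, the components of $\omega$ are the classical forms $\omega^j=\omega(\cdot,v_j)$; smoothness and the differential ($(\mathrm{d}\omega)^j=\mathrm{d}(\omega^j)$) are defined componentwise. **Currents.** A $k$-dimensional $E$-current is a continuous linear functional on the space of smooth compactly supported $E^*$-valued $k$-forms (usual test-function topology). Its boundary is $\langle\partial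 T;\varphi\rangle=\langle T;\mathrm{d}\varphi\rangle$, its mass is $\mathbb{M}(T)=\sup_{\|\omega\|\le1}\langle T;\omega\rangle$. $T$ is normal if $\mathbb{M}(T)+\mathbb{M}(\partial T)<+\infty$. A rectifiable $E$-current $T=T(\Sigma,\tau,\theta)$ of dimension $k$ is one of the form $\langle T;\omega\rangle=\int_\Sigma\langle\omega(x);\tau(x),\theta(x)\rangle\,\mathrm{d}\mathscr{H}^k(x)$, with $\Sigma$ countably $k$-rectifiable, $\tau$ a unit simple $k$-vector orienting the approximate tangent space of $\Sigma$ ($\mathscr{H}^k$-a.e.), and $\theta\in L^1(\mathscr{H}^k\llcorner\Sigma;E)$. It is a rectifiable $G$-current if $\theta$ takes values in $G$ and the same holds in such a representation of $\partial T$. **Smooth calibration.** A smooth calibration associated with a $k$-dimensional rectifiable $G$-current $T(\Sigma,\tau,\theta)$ in $\mathbb{R}^d$ is a smooth compactly supported $E^*$-valued $k$-form $\omega$ such that: (i) $\langle\omega(x);\tau(x),\theta(x)\rangle=\|\theta(x)\|_E$ for $\mathscr{H}^k$-a.e. $x\in\Sigma$; (ii) $\mathrm{d}\omega=0$; (iii) $\|\omega\|\le1$. *)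

(* Defs.v *)
From HB Require Import structures.
From mathcomp Require Import all_boot all_order all_algebra.
From mathcomp Require Import all_classical all_reals all_analysis.

Set Implicit Arguments.
Unset Strict Implicit.
Unset Printing Implicit Defensive.

Import Order.TTheory GRing.Theory Num.Theory.
Import numFieldNormedType.Exports.

Local Open Scope classical_set_scope.
Local Open Scope ring_scope.

#[short(type="finNormedModType")]
HB.structure Definition FinNormedModule (R : numDomainType) :=
  {V of NormedModule R V & Vector R V}.

Definition discrete_subgroup (R : realType) (E : normedModType R)
    (G : set E) : Prop :=
  [/\ G 0, forall g h, G g -> G h -> G (g - h) & G `<=` isolated G].

Section Hausdorff.
Variables (R : realType) (d : nat).
Implicit Types (A : set 'rV[R]_d) (U : (set 'rV[R]_d)^nat) (k : nat).

(* The library norm on 'rV_d is the sup norm; metric notions below use the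
   Euclidean one. *)
Definition enorm n (x : 'rV[R]_n) : R := Num.sqrt (\sum_(i < n) x 0 i ^+ 2).

Definition diam A : \bar R :=
  ereal_sup [set (enorm (p.1 - p.2))%:E | p in A `*` A].

(* Lebesgue measure of the Euclidean unit ball of R^k, pi^(k/2)/Gamma(k/2+1). *)
Fixpoint unit_ball_volume k : R :=
  match k with
  | 0%N => 1
  | 1%N => 2
  | k'.+2 => 2 * pi / k%:R * unit_ball_volume k'
  end.

(* diam set0 = -oo; for k = 0 every nonempty set has gauge 1. *)
Definition hausdorff_gauge k A : \bar R :=
  if A == set0 then 0%E
  else ((unit_ball_volume k / 2 ^+ k)%:E * diam A ^+ k)%E.

Definition hausdorff_delta k (delta : R) A : \bar R :=
  ereal_inf [set (\sum_(j <oo) hausdorff_gauge k (U j))%E | U in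
    [set U | (forall j, (diam (U j) <= delta%:E)%E) /\ A `<=` \bigcup_j U j]].

Definition hausdorff k A : \bar R :=
  ereal_sup [set hausdorff_delta k delta A | delta in [set delta | 0 < delta]].

Lemma unit_ball_volume_ge0 k : 0 <= unit_ball_volume k.
Proof.
suff : 0 <= unit_ball_volume k /\ 0 <= unit_ball_volume k.+1 by case.
elim: k => [|k [IH0 IH1]]; first by rewrite /= ler01 ler0n.
split=> //; rewrite [unit_ball_volume _]/= mulr_ge0//.
by rewrite divr_ge0// mulr_ge0// pi_ge0.
Qed.

Lemma diam_ge0 A : A !=set0 -> (0 <= diam A)%E.
Proof.
case=> x Ax; apply: ereal_sup_ubound; exists (x, x) => //=.
by rewrite subrr /enorm big1 ?sqrtr0// => i _; rewrite mxE expr0n.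
Qed.

Lemma hausdorff_gauge_ge0 k A : (0 <= hausdorff_gauge k A)%E.
Proof.
rewrite /hausdorff_gauge; case: eqP => // /eqP /set0P /diam_ge0 A0.
by rewrite mule_ge0 ?expe_ge0// lee_fin divr_ge0 ?unit_ball_volume_ge0.
Qed.

Let cut_gauge k (delta : R) A : \bar R :=
  if (diam A <= delta%:E)%E then hausdorff_gauge k A else +oo%E.

Let cut_gauge_ge0 k delta A : (0 <= cut_gauge k delta A)%E.
Proof. by rewrite /cut_gauge; case: ifP => // _; exact: hausdorff_gauge_ge0. Qed.

Local Notation rV_discrete := (g_sigma_algebraType [set: set 'rV[R]_d]).

Let diam0 : diam set0 = -oo%E.
Proof. by rewrite /diam setX0 image_set0 ereal_sup0. Qed.

Let hausdorff_deltaE k delta :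
  hausdorff_delta k delta = mu_ext (cut_gauge k delta : set rV_discrete -> \bar R).
Proof.
apply/funext => A; apply/eqP; rewrite eq_le; apply/andP; split.
  apply: le_ereal_inf_tmp => _ [U [_ AU] <-].
  have [dU|] := pselect (forall j, (diam (U j) <= delta%:E)%E).
    apply: ereal_inf_lbound; exists U => //.
    by apply: eq_eseriesr => j _; rewrite /cut_gauge dU.
  move=> /existsNP[j /negP/negbTE dj].
  by rewrite (@eseries_pinfty _ _ _ j) ?leey// => [n _|];
    rewrite ?/cut_gauge ?dj// -ltNye (lt_le_trans _ (cut_gauge_ge0 _ _ _)).
apply: le_ereal_inf_tmp => _ [U [dU AU] <-].
apply: ereal_inf_lbound; exists U.
  by split=> // j; exact: sub_sigma_algebra.
by apply: eq_eseriesr => j _; rewrite /cut_gauge dU.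
Qed.

Let cut_gauge0 k delta : cut_gauge k delta set0 = 0%E.
Proof. by rewrite /cut_gauge diam0 leNye /hausdorff_gauge eqxx. Qed.

Lemma hausdorff0 k : hausdorff k set0 = 0%E.
Proof.
rewrite /hausdorff (_ : [set _ | _ in _] = [set 0%E]) ?ereal_sup1//.
apply/seteqP; split=> [_ [e e0 <-]|_ ->] /=.
  by rewrite hausdorff_deltaE mu_ext0//; exact: cut_gauge_ge0.
by exists 1 => //; rewrite hausdorff_deltaE mu_ext0//; exact: cut_gauge_ge0.
Qed.

Lemma hausdorff_ge0 k A : (0 <= hausdorff k A)%E.
Proof.
apply: (@le_trans _ _ (hausdorff_delta k 1 A)).
  by rewrite hausdorff_deltaE mu_ext_ge0//; exact: cut_gauge_ge0.
by apply: ereal_sup_ubound; exists 1 => //=.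
Qed.

Lemma le_hausdorff k : {homo hausdorff k : A B / A `<=` B >-> (A <= B)%E}.
Proof.
move=> A B AB; apply: ge_ereal_sup => _ [e e0 <-].
apply: (@le_trans _ _ (hausdorff_delta k e B)).
  by rewrite hausdorff_deltaE; exact: le_mu_ext.
by apply: ereal_sup_ubound; exists e.
Qed.

Lemma hausdorff_sigma_subadditive k : sigma_subadditive (hausdorff k).
Proof.
move=> F; apply: ge_ereal_sup => _ [e e0 <-].
apply: (@le_trans _ _ (\sum_(i <oo) hausdorff_delta k e (F i))%E).
  by rewrite hausdorff_deltaE; apply: mu_ext_sigma_subadditive => //;
    exact: cut_gauge_ge0.
apply: lee_nneseries => [i _ _|i _].
  by rewrite hausdorff_deltaE mu_ext_ge0//; exact: cut_gauge_ge0.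
by apply: ereal_sup_ubound; exists e.
Qed.

HB.instance Definition _ k := isOuterMeasure.Build R 'rV[R]_d (hausdorff k)
  (hausdorff0 k) (@hausdorff_ge0 k) (@le_hausdorff k)
  (@hausdorff_sigma_subadditive k).

Definition hausdorff_outer k : {outer_measure set 'rV[R]_d -> \bar R} :=
  hausdorff k.

(* R^d with the sigma-algebra of the (Caratheodory) H^k-measurable sets. *)
Local Notation hausdorff_type k := (caratheodory_type (hausdorff_outer k)).

Definition Hmeasure k : {measure set (hausdorff_type k) -> \bar R} :=
  hausdorff_outer k : set (hausdorff_type k) -> \bar R.

End Hausdorff.
Notation hausdorff_type R d k := (caratheodory_type (@hausdorff_outer R d k)).
Arguments Hmeasure : clear implicits.

Section Multivectors.
Variables (R : realType) (d : nat).
Implicit Types k : nat.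

Definition increasing k (f : {ffun 'I_k -> 'I_d}) : bool :=
  [forall i : 'I_k, forall j : 'I_k, (i < j)%N ==> (f i < f j)%N].

(* The multi-indices i_1 < ... < i_k in {0, ..., d-1}. *)
Definition multi_index k := {f : {ffun 'I_k -> 'I_d} | increasing f}.

(* Lambda_k(R^d), in coordinates on the basis e_I = e_(i_1) /\ ... /\ e_(i_k). *)
Definition kvector k := {ffun multi_index k -> R^o}.

Definition kbasis k (I : multi_index k) : kvector k := [ffun J => (J == I)%:R].

(* v_1 /\ ... /\ v_k, where v_1, ..., v_k are the rows of V: the coordinates
   are the k x k minors of V. *)
Definition wedge k (V : 'M[R]_(k, d)) : kvector k :=
  [ffun I : multi_index k => \det (colsub (val I) V)].

(* tau = c v_1 /\ ... /\ v_k; the scalar only matters for k = 0. *)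
Definition kvector_spanned_by k (tau : kvector k) (V : 'M[R]_(k, d)) : Prop :=
  exists c : R, tau = c *: wedge V.

Definition simple_kvector k (tau : kvector k) : Prop :=
  exists V, kvector_spanned_by tau V.

Definition kvector_norm k (tau : kvector k) : R := Num.sqrt (\sum_I tau I ^+ 2).

Lemma increasing_face k (J : multi_index k.+1) (r : 'I_k.+1) :
  increasing [ffun i => val J (lift r i)].
Proof.
apply/'forall_forallP => i j; apply/implyP => ij; rewrite !ffunE.
have /'forall_forallP/(_ (lift r i) (lift r j))/implyP := valP J; apply.
by rewrite ltnNge /= leq_bump2 -ltnNge.
Qed.

(* The multi-index J with its r-th entry removed. *)
Definition face k (J : multi_index k.+1) (r : 'I_k.+1) : multi_index k :=
  Sub [ffun i => val J (lift r i)] (increasing_face J r).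

End Multivectors.
Arguments kvector : clear implicits.
Arguments kbasis R {d k}.

Section Forms.
Variables (R : realType) (d : nat) (E : finNormedModType R).
Implicit Types k : nat.

(* Iterated partial derivative along the coordinates listed in s. *)
Fixpoint partials (s : seq 'I_d) (f : 'rV[R]_d -> R) : 'rV[R]_d -> R :=
  if s is i :: s' then fun x => 'D_(delta_mx 0 i) (partials s' f) x else f.

Definition smooth (f : 'rV[R]_d -> R) : Prop :=
  forall s : seq 'I_d, continuous (partials s f) /\
    forall x i, derivable (partials s f) x (delta_mx 0 i).

(* An E^*-valued k-covector is such a map which is bilinear. *)
Definition precovector k := kvector R d k -> E -> R^o.

Definition dual_norm (f : E -> R) : \bar R :=
  ereal_sup [set (f v)%:E | v in [set v : E | `|v| <= 1]].

Definition covector_comass k (w : precovector k) : \bar R :=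
  ereal_sup [set dual_norm (w tau) | tau in
    [set tau | simple_kvector tau /\ kvector_norm tau <= 1]].

Definition Eform k := 'rV[R]_d -> precovector k.

Definition comass k (w : Eform k) : \bar R :=
  ereal_sup [set covector_comass (w x) | x in setT].

(* The coefficient on dx^I of the component w(., v) of w. *)
Definition coef k (w : Eform k) (I : multi_index d k) (v : E) : 'rV[R]_d -> R :=
  fun x => w x (kbasis R I) v.

Definition supported_in k (K : set 'rV[R]_d) (w : Eform k) : Prop :=
  forall x, ~ K x -> forall tau v, w x tau v = 0.

(* The smooth compactly supported E^*-valued k-forms; by linearity in v,
   smoothness of the components in one basis of E is smoothness of w(., v) for
   every v. *)
Record test_form k (w : Eform k) : Prop := TestForm {
  test_form_bilinear : forall x, bilinear_for *:%R *:%R (w x);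
  test_form_smooth : forall I v, smooth (coef w I v);
  test_form_support : exists2 K, compact K & supported_in K w }.

(* (dw)_J = \sum_r (-1)^r d_(j_r) w_(J minus j_r) for J = (j_0 < ... < j_k). *)
Definition ext_d k (w : Eform k) : Eform k.+1 := fun x tau v =>
  \sum_(J : multi_index d k.+1) tau J *
    \sum_(r < k.+1) (-1) ^+ r *
      'D_(delta_mx 0 (val J r)) (coef w (face J r) v) x.

End Forms.

Section Currents.
Variables (R : realType) (d : nat) (E : finNormedModType R).
Implicit Types k : nat.

(* Only the values on test forms are meaningful. *)
Definition functional k := Eform d E k -> R.

Definition eq_current k (T S : functional k) : Prop :=
  forall w, test_form w -> T w = S w.

(* Continuity for the inductive limit topology of the spaces D_K of test forms
   supported in a compact set K: the restriction to each D_K is continuous (at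
   0) for the uniform convergence of all partial derivatives. *)
Definition continuous_on_test_forms k (T : functional k) : Prop :=
  forall K : set 'rV[R]_d, compact K -> forall e : R, 0 < e ->
  exists N : nat, exists2 delta : R, 0 < delta &
  forall w : Eform d E k, test_form w -> supported_in K w ->
    (forall (s : seq 'I_d) I v x, (size s <= N)%N -> `|v| <= 1 ->
      `|partials s (coef w I v) x| <= delta) ->
    `|T w| <= e.

Record current k (T : functional k) : Prop := Current {
  current_linear : forall (a : R) (w w' : Eform d E k),
    test_form w -> test_form w' ->
    T (fun x tau v => a * w x tau v + w' x tau v) = a * T w + T w';
  current_continuous : continuous_on_test_forms T }.

(* Currents of dimension 0 have no boundary: for k = 0 the boundary is 0. *)
Definition boundary k : functional k -> functional k.-1 :=
  match k with
  | 0%N => fun _ _ => 0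
  | k'.+1 => fun T w => T (ext_d w)
  end.

Definition mass k (T : functional k) : \bar R :=
  ereal_sup [set (T w)%:E | w in
    [set w : Eform d E k | test_form w /\ (comass w <= 1)%E]].

Definition normal_current k (T : functional k) : Prop :=
  current T /\ (mass T + mass (boundary T) < +oo)%E.

End Currents.

Section Rectifiable.
Variables (R : realType) (d : nat).
Implicit Types (k : nat) (Sigma : set 'rV[R]_d).

Local Notation H := (Hmeasure R d).
Local Notation Hmeasurable k :=
  (@measurable _ (hausdorff_type R d k)).

Definition lipschitz_map m n (f : 'rV[R]_m -> 'rV[R]_n) : Prop :=
  exists L : R, forall y z, enorm (f y - f z) <= L * enorm (y - z).

Definition countably_rectifiable k Sigma : Prop :=
  Hmeasurable k Sigma /\
  exists (N : set 'rV[R]_d) (F : nat -> 'rV[R]_k -> 'rV[R]_d),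
    [/\ H k N = 0%E, forall j, lipschitz_map (F j)
      & Sigma `<=` N `|` \bigcup_j range (F j)].

(* Positive, locally H^k-integrable functions on Sigma. *)
Definition tangent_weight k Sigma (rho : hausdorff_type R d k -> R) : Prop :=
  [/\ forall x, Sigma x -> 0 < rho x,
      measurable_fun (Sigma : set (hausdorff_type R d k)) rho
    & forall K : set 'rV[R]_d, compact K ->
      (\int[H k]_(x in Sigma `&` K) (rho x)%:E < +oo)%E].

(* P is the approximate tangent space of Sigma at x with respect to the weight
   rho: the blow-ups of rho H^k|_Sigma at x converge to rho(x) H^k|_P. *)
Definition approx_tangent_space k Sigma (rho : hausdorff_type R d k -> R)
    (x : 'rV[R]_d) (P : set 'rV[R]_d) : Prop :=
  forall f : 'rV[R]_d -> R, continuous f ->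
  (exists2 K, compact K & forall y, ~ K y -> f y = 0) ->
  (fun l : R =>
     l ^- k * \int[H k]_(y in Sigma) (f (l^-1 *: (y - x)) * rho y)) @ 0^'+
    --> rho x * \int[H k]_(y in P) f y.

(* tau is H^k-a.e. on Sigma a unit simple k-vector orienting the approximate
   tangent space. A countably rectifiable set need not be locally H^k-finite,
   hence the weight; a.e. the approximate tangent space does not depend on
   it. *)
Definition orientation k Sigma (tau : 'rV[R]_d -> kvector R d k) : Prop :=
  (forall I, measurable_fun (Sigma : set (hausdorff_type R d k))
     (fun x => tau x I : R)) /\
  exists2 rho, @tangent_weight k Sigma rho &
    {ae H k, forall x, Sigma x ->
      kvector_norm (tau x) = 1 /\
      exists2 V : 'M[R]_(k, d), kvector_spanned_by (tau x) V &
        @approx_tangent_space k Sigma rho x [set y | (y <= V)%MS]}.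

Variable E : finNormedModType R.

(* theta is in L^1(H^k|_Sigma; E). *)
Definition L1_multiplicity k Sigma (theta : 'rV[R]_d -> E) : Prop :=
  (forall U : set E, open U -> Hmeasurable k (Sigma `&` theta @^-1` U)) /\
  (\int[H k]_(x in Sigma) `|theta x|%:E < +oo)%E.

(* T = T(Sigma, tau, theta). *)
Definition rectifiable_rep k (T : functional d E k) Sigma
    (tau : 'rV[R]_d -> kvector R d k) (theta : 'rV[R]_d -> E) : Prop :=
  [/\ countably_rectifiable k Sigma, orientation Sigma tau,
      L1_multiplicity k Sigma theta
    & forall w, test_form w ->
      T w = \int[H k]_(x in Sigma) (w x (tau x) (theta x) : R)].

Definition G_valued k (G : set E) Sigma (theta : 'rV[R]_d -> E) : Prop :=
  {ae H k, forall x, Sigma x -> G (theta x)}.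

Definition rectifiable_G_current k (G : set E) (T : functional d E k) Sigma
    (tau : 'rV[R]_d -> kvector R d k) (theta : 'rV[R]_d -> E) : Prop :=
  [/\ current T, rectifiable_rep T Sigma tau theta, G_valued k G Sigma theta
    & exists Sigma' tau' theta',
      rectifiable_rep (boundary T) Sigma' tau' theta' /\
      G_valued k.-1 G Sigma' theta'].

Definition smooth_calibration k Sigma
    (tau : 'rV[R]_d -> kvector R d k) (theta : 'rV[R]_d -> E)
    (w : Eform d E k) : Prop :=
  [/\ test_form w,
      {ae H k, forall x, Sigma x -> w x (tau x) (theta x) = `|theta x|},
      forall x sigma v, ext_d w x sigma v = 0
    & (comass w <= 1)%E].

End Rectifiable.

(* Main.v *)
(** Evaluating T on test forms gives M(T) <= \int_Sigma |theta| = <T; omega>, so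
    it suffices that the cycle S = T - T' of finite mass vanishes on the closed
    form omega. Let e be a coordinate vector. By Cartan's formula the derivative
    D_e omega of a closed form is exact, with the compactly supported primitive
    i_e omega (and D_e omega = 0 if k = 0), so S(D_e omega) = 0. As S is bounded
    by the comass, Taylor's formula then makes S(omega) invariant under
    translations of omega along e. The sum of n translates of omega with disjoint
    supports has comass at most 1, hence n S(omega) <= M(T) + M(T') for all n,
    and S(omega) <= 0. *)

From HB Require Import structures.
Require Import Defs.
From mathcomp Require Import all_boot all_order all_algebra.
From mathcomp Require Import all_classical all_reals all_analysis measurable_realfun.
From mathcomp Require Import ring lra zify.

Set Implicit Arguments.
Unset Strict Implicit.
Unset Printing Implicit Defensive.

Import Order.TTheory GRing.Theory Num.Theory.
Import numFieldNormedType.Exports HBNNSimple.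

Local Open Scope classical_set_scope.
Local Open Scope ring_scope.

(** * Comparison of integrals without measurability of the smaller function *)

Section Integral.
Context disp (X : measurableType disp) (R : realType).
Variable mu : {measure set X -> \bar R}.

(** The integral of [f] is a supremum over simple functions [h] below [f]. Each [h] is measurable
    and a.e. below [g], so the usual comparison applies to [h] even when it does not apply to
    [f]. *)
Lemma ge0_le_integral_ae_dominated (D : set X) (f g : X -> \bar R) :
  measurable D -> measurable_fun D g ->
  (forall x, D x -> 0 <= f x)%E -> (forall x, D x -> 0 <= g x)%E ->
  {ae mu, forall x, D x -> (f x <= g x)%E} ->
  (\int[mu]_(x in D) f x <= \int[mu]_(x in D) g x)%E.
Proof.
move=> mD mg f0 g0 fg; rewrite (ge0_integralE _ f0).
apply: ge_ereal_sup => _ [h hf <-]; rewrite -integralT_nnsfun (integral_mkcond D).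
apply: ae_ge0_le_integral => //.
- by move=> x _; rewrite lee_fin; exact: fun_ge0.
- exact/measurable_EFinP.
- by move=> x _; apply: erestrict_ge0 => y; exact: g0.
- exact/(measurable_restrictT _ _).1.
- apply: filterS fg => x fgx _; apply: (le_trans (hf x)).
  by rewrite /patch; case: ifPn => // /set_mem; exact: fgx.
Qed.

(** Both the positive and the negative part of [f] have integral at most that of [g]. This serves
    for the integrand [w x (tau x) (theta x)], whose measurability then need not be established. *)
Lemma Rintegral_le_ae (D : set X) (f g : X -> R) :
  measurable D -> measurable_fun D g -> (forall x, 0 <= g x) ->
  (\int[mu]_(x in D) (g x)%:E < +oo)%E ->
  {ae mu, forall x, D x -> `|f x| <= g x} ->
  \int[mu]_(x in D) f x <= \int[mu]_(x in D) g x.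
Proof.
move=> mD mg g0 gfin fg; have mg' : measurable_fun D (EFin \o g).
  exact/measurable_EFinP.
have le (F : X -> \bar R) : (forall x, 0 <= F x)%E ->
    (forall x, F x <= `|f x|%:E)%E ->
    (\int[mu]_(x in D) F x <= \int[mu]_(x in D) (g x)%:E)%E.
  move=> F0 Ff; apply: ge0_le_integral_ae_dominated => //.
    by move=> x _; rewrite lee_fin.
  apply: filterS fg => x fgx Dx; apply: (le_trans (Ff x)).
  by rewrite lee_fin fgx.
rewrite /Rintegral integralE.
set a := (\int[mu]_(x in D) (_ ^\+ x))%E; set b := (\int[mu]_(x in D) (_ ^\- x))%E.
set c := (\int[mu]_(x in D) (g x)%:E)%E.
have a0 : (0 <= a)%E by exact: integral_ge0.
have b0 : (0 <= b)%E by exact: integral_ge0.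
have ac : (a <= c)%E.
  by apply: le => // x; rewrite funeposE -EFin_max lee_fin ge_max ler_norm normr_ge0.
have bc : (b <= c)%E.
  by apply: le => // x; rewrite funenegE -EFinN -EFin_max lee_fin ge_max -normrN ler_norm normr_ge0.
have cf : c \is a fin_num by rewrite ge0_fin_numE// (le_trans a0).
have af : a \is a fin_num by rewrite ge0_fin_numE// (le_lt_trans ac).
have bf : b \is a fin_num by rewrite ge0_fin_numE// (le_lt_trans bc).
(* [fine] is monotone only between finite values, hence the bounds on both parts. *)
by apply: fine_le => //; [rewrite fin_numB af|rewrite (le_trans _ ac)// leeBlDr// leeDl].
Qed.

End Integral.

(** * Bilinear covectors and their comass *)

Section Covectors.
Variables (R : realType) (d k : nat) (E : finNormedModType R).
Implicit Types (p : precovector d E k) (tau : kvector R d k) (v : E).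

Lemma linear_pack (U V : lmodType R) (f : U -> V) :
  linear f -> exists g : {linear U -> V}, f = g.
Proof.
move=> lf; pose m := GRing.isLinear.Build _ _ _ _ _ lf.
by pose g : {linear U -> V} := HB.pack f m; exists g.
Qed.

Lemma kvector_sum_basis tau : tau = \sum_I tau I *: kbasis R I.
Proof.
apply/ffunP => J; rewrite sum_ffunE (bigD1 J)//= big1 ?addr0.
  by rewrite !ffunE eqxx /GRing.scale/= mulr1.
by move=> I IJ; rewrite !ffunE eq_sym (negbTE IJ) scaler0.
Qed.

Section Bilinear.
Variable p : precovector d E k.
Hypothesis bp : bilinear_for *:%R *:%R p.

Lemma covectorDl (a : R) tau tau' v :
  p (a *: tau + tau') v = a * p tau v + p tau' v.
Proof. by case: bp => + _ => /(_ v a tau tau'). Qed.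

Lemma covectorDr (a : R) tau v v' :
  p tau (a *: v + v') = a * p tau v + p tau v'.
Proof. by case: bp => _ /(_ tau a v v'). Qed.

Lemma covector_suml (J : finType) (c : J -> R) (t : J -> kvector R d k) v :
  p (\sum_j c j *: t j) v = \sum_j c j * p (t j) v.
Proof.
have [g pg] := linear_pack (bp.1 v).
rewrite -[LHS]/(p^~ v (\sum_j c j *: t j)) pg linear_sum.
by apply: eq_bigr => j _; rewrite linearZ -pg.
Qed.

Lemma covector_sumr (J : finType) (c : J -> R) (u : J -> E) tau :
  p tau (\sum_j c j *: u j) = \sum_j c j * p tau (u j).
Proof.
have [g pg] := linear_pack (bp.2 tau).
rewrite pg linear_sum; apply: eq_bigr => j _; by rewrite linearZ.
Qed.

Lemma covectorE tau v : p tau v = \sum_I tau I * p (kbasis R I) v.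
Proof. by rewrite {1}(kvector_sum_basis tau) covector_suml. Qed.

Lemma covector0r tau : p tau 0 = 0.
Proof. by have [g ->] := linear_pack (bp.2 tau); rewrite linear0. Qed.

Lemma covectorZr tau a v : p tau (a *: v) = a * p tau v.
Proof. by have [g ->] := linear_pack (bp.2 tau); rewrite linearZ. Qed.

(** Homogeneity in [v] reduces to unit vectors. The dual norm is a supremum of signed values, so the
    absolute value comes from using [v] and its opposite. *)
Lemma covector_le_norm tau v : (covector_comass p <= 1)%E ->
  simple_kvector tau -> kvector_norm tau <= 1 -> `|p tau v| <= `|v|.
Proof.
move=> p1 st nt.
have le1 u : `|u| <= 1 -> p tau u <= 1.
  move=> u1; rewrite -lee_fin (le_trans _ p1)//.
  apply: (@le_trans _ _ (dual_norm (p tau))); apply: ereal_sup_ubound.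
    by exists u.
  by exists tau.
have leN u : p tau u <= `|u|.
  have [->|u0] := eqVneq u 0; first by rewrite covector0r normr0.
  have up : 0 < `|u| by rewrite normr_gt0.
  have := le1 (`|u|^-1 *: u); rewrite normrZ normfV normr_id mulVf ?gt_eqF//.
  by rewrite covectorZr ler_pdivrMl// mulr1; apply.
rewrite ler_norml leN andbT lerNl.
by have := leN (-1 *: v); rewrite covectorZr mulN1r scaleN1r normrN.
Qed.

End Bilinear.

Lemma covector_comass_le p (c : R) :
  (forall tau v, simple_kvector tau -> kvector_norm tau <= 1 -> `|v| <= 1 ->
    p tau v <= c) -> (covector_comass p <= c%:E)%E.
Proof.
move=> pc; apply: ge_ereal_sup => _ [tau [st nt] <-].
by apply: ge_ereal_sup => _ [v v1 <-]; rewrite lee_fin pc.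
Qed.

Lemma comassP (w : Eform d E k) (c : \bar R) :
  (comass w <= c)%E <-> forall x, (covector_comass (w x) <= c)%E.
Proof.
split=> [wc x|wc]; last by apply: ge_ereal_sup => _ [x _ <-].
by apply: (le_trans _ wc); apply: ereal_sup_ubound; exists x.
Qed.

End Covectors.

(** * Rectifiable currents: the integral of the multiplicity bounds the mass and is attained by a
    calibration *)

Section RectifiableMass.
Variables (R : realType) (d k : nat) (E : finNormedModType R).
Variables (T : functional d E k) (Sigma : set 'rV[R]_d).
Variables (tau : 'rV[R]_d -> kvector R d k) (theta : 'rV[R]_d -> E).
Hypothesis rT : rectifiable_rep T Sigma tau theta.

Let thetaL1 : L1_multiplicity k Sigma theta.
Proof. by case: rT. Qed.

Let mSigma : @measurable _ (hausdorff_type R d k) Sigma.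
Proof. by case: rT => -[]. Qed.

(** Open rays generate the Borel sets of the line, and their preimages under the norm are open in
    [E]. *)
Lemma L1_multiplicity_measurable_norm :
  measurable_fun (Sigma : set (hausdorff_type R d k)) (fun x => `|theta x|).
Proof.
case: thetaL1 => mth _ mS; apply: (measurability _ (RGenOInfty.measurableE R)) => //.
move=> _ [_ [a ->] <-]; rewrite preimage_itvoy.
apply: (mth [set v : E | a < `|v|]).
by apply: (@open_comp _ _ (fun v : E => `|v|) [set r | a < r]);
  [move=> v _; exact: norm_continuous|exact: open_gt].
Qed.

Lemma rectifiable_le_norm (w : Eform d E k) : test_form w -> (comass w <= 1)%E ->
  T w <= \int[Hmeasure R d k]_(x in Sigma) `|theta x|.
Proof.
move=> tw /comassP w1; case: rT => _ [_ [rho _ tau1]] _ ->//.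
apply: (@Rintegral_le_ae _ (hausdorff_type R d k) R (Hmeasure R d k) Sigma
  (fun x => w x (tau x) (theta x)) (fun x => `|theta x|)).
- exact: mSigma.
- exact: L1_multiplicity_measurable_norm.
- by move=> x; exact: normr_ge0.
- by case: thetaL1.
- apply: negligibleS tau1; apply: subsetC => x tau1 Sx.
  have [n1 [V sV _]] := tau1 Sx.
  by apply: covector_le_norm; rewrite ?n1//; [case: tw|exists V].
Qed.

Lemma calibrated_eq_norm (w : Eform d E k) : smooth_calibration Sigma tau theta w ->
  T w = \int[Hmeasure R d k]_(x in Sigma) `|theta x|.
Proof.
case: rT => _ _ _ rep [tw wth _ _]; rewrite rep// /Rintegral.
pose g : hausdorff_type R d k -> \bar R := fun x => `|theta x|%:E.
pose f : hausdorff_type R d k -> \bar R := fun x => (w x (tau x) (theta x) : R)%:E.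
have mg : measurable_fun (Sigma : set (hausdorff_type R d k)) g.
  by apply/measurable_EFinP; exact: L1_multiplicity_measurable_norm.
have ae : ae_eq (Hmeasure R d k) (Sigma : set (hausdorff_type R d k)) g f.
  by apply: negligibleS wth; apply: subsetC => x wx Sx; rewrite /g /f wx.
congr fine; apply/esym.
apply: (@ae_eq_integral _ (hausdorff_type R d k) R (Hmeasure R d k) Sigma f g mSigma mg _ ae).
(* The Caratheodory measure is complete, so [f] inherits measurability from [g], to which it is a.e.
   equal. *)
by apply: (ae_measurable_fun _ ae) => //; apply: measure_is_complete_caratheodory.
Qed.

End RectifiableMass.

(** * Calculus of smooth functions along coordinate directions *)

Section Smooth.
Variables (R : realType) (d : nat).
Implicit Types (f g : 'rV[R]_d -> R) (s : seq 'I_d) (x : 'rV[R]_d) (i : 'I_d).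

Local Notation e_ i := (delta_mx 0 i : 'rV[R]_d).

Lemma derive_lin (a : R) f g x (v : 'rV[R]_d) : derivable f x v -> derivable g x v ->
  'D_v (fun y => a * f y + g y) x = a * 'D_v f x + 'D_v g x.
Proof.
by move=> df dg; have := deriveD (@derivableZ _ _ _ f a x v df) dg; rewrite deriveZ.
Qed.

Lemma derivable_lin (a : R) f g x (v : 'rV[R]_d) : derivable f x v ->
  derivable g x v -> derivable (fun y => a * f y + g y) x v.
Proof.
by move=> df dg; apply: (@derivableD _ _ _ (a *: f) g) => //; exact: derivableZ.
Qed.

Lemma smooth_derivable f x i : smooth f -> derivable f x (e_ i).
Proof. by move=> /(_ [::])[_]; apply. Qed.

Arguments smooth_derivable [f] x i.

Lemma partials_lin (a : R) f g s : smooth f -> smooth g ->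
  partials s (fun y => a * f y + g y) =
  (fun y => a * partials s f y + partials s g y).
Proof.
move=> sf sg; elim: s => [//|i s IH] /=; rewrite IH.
by apply/funext => x; rewrite derive_lin//; [apply: (sf s).2|apply: (sg s).2].
Qed.

Lemma smooth_lin (a : R) f g : smooth f -> smooth g ->
  smooth (fun y => a * f y + g y).
Proof.
move=> sf sg s; rewrite partials_lin//; split=> [x|x i].
  apply: (@continuousD _ _ _ (fun y => a * partials s f y)); last exact: (sg s).1.
  apply: (@continuousM _ _ (cst a)); last exact: (sf s).1.
  exact: cst_continuous.
by apply: derivable_lin; [apply: (sf s).2|apply: (sg s).2].
Qed.

Lemma partials0 s : partials s (fun _ : 'rV[R]_d => 0 : R) = (fun=> 0).
Proof.
by elim: s => [//|i s IH] /=; rewrite IH; apply/funext => x; exact: derive_cst.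
Qed.

Lemma smooth0 : smooth (fun _ : 'rV[R]_d => 0 : R).
Proof.
move=> s; rewrite partials0; split=> [x|x i]; first exact: (@cst_continuous _ R 0).
exact: derivable_cst.
Qed.

Lemma smooth_sum (J : Type) (r : seq J) (c : J -> R) (f : J -> 'rV[R]_d -> R) :
  (forall j, smooth (f j)) -> smooth (fun x => \sum_(j <- r) c j * f j x).
Proof.
move=> sf; elim: r => [|j r IH].
  by rewrite (_ : (fun _ => _) = fun=> 0); [exact: smooth0|apply/funext => x; rewrite big_nil].
rewrite (_ : (fun _ => _) = fun x => c j * f j x + \sum_(j <- r) c j * f j x).
  exact: smooth_lin.
by apply/funext => x; rewrite big_cons.
Qed.

(** [partials] differentiates first along the last index of the list; this makes smoothness stable
    under a partial derivative. *)
Lemma partials_rcons f s i : partials (rcons s i) f = partials s ('D_(e_ i) f).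
Proof. by elim: s => //= j s ->. Qed.

Lemma smooth_derive f i : smooth f -> smooth ('D_(e_ i) f).
Proof. by move=> sf s; rewrite -partials_rcons. Qed.

Arguments smooth_derive [f] i.

Lemma derive_translate f (c x v : 'rV[R]_d) :
  'D_v (fun y => f (y + c)) x = 'D_v f (x + c).
Proof.
by rewrite /derive; under eq_fun do rewrite /= -addrA.
Qed.

Lemma derivable_translate f (c x v : 'rV[R]_d) :
  derivable f (x + c) v -> derivable (fun y => f (y + c)) x v.
Proof. by rewrite /derivable; under eq_fun do rewrite /= addrA. Qed.

Lemma partials_translate f s (c : 'rV[R]_d) :
  partials s (fun y => f (y + c)) = fun y => partials s f (y + c).
Proof.
by elim: s => //= i s ->; apply/funext => x; rewrite derive_translate.
Qed.

Lemma smooth_translate f (c : 'rV[R]_d) : smooth f -> smooth (fun y => f (y + c)).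
Proof.
move=> sf s; rewrite partials_translate; split=> [x|x i].
  suff : {for x, continuous (partials s f \o (fun y : 'rV[R]_d => y + c))} by [].
  apply: continuous_comp; last exact: (sf s).1.
  apply: (@continuousD _ _ _ id (cst c)); first exact: cvg_id.
  exact: cst_continuous.
by apply: derivable_translate; exact: (sf s).2.
Qed.

Lemma derive_supported f (K : set 'rV[R]_d) (v : 'rV[R]_d) : closed K ->
  (forall x, ~ K x -> f x = 0) -> forall x, ~ K x -> 'D_v f x = 0.
Proof.
move=> cK f0 x Kx; rewrite (@near_eq_derive _ _ _ f (cst 0)) ?derive_cst//.
have : nbhs x (~` K) by apply: open_nbhs_nbhs; split=> //; exact: closed_openC.
by apply: filterS => y; exact: f0.
Qed.

Lemma continuous_compact_support_bounded f (K : set 'rV[R]_d) : compact K ->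
  continuous f -> (forall x, ~ K x -> f x = 0) ->
  exists2 C, 0 <= C & forall x, `|f x| <= C.
Proof.
move=> cK cf f0.
have [] := @compact_bounded R R (f @` K).
  by apply: continuous_compact => //; exact: continuous_subspaceT.
(* Boundedness provides a bound by every number above [M]; this choice is also nonnegative. *)
move=> M [_ /(_ (`|M| + 1))]; have MM : M < `|M| + 1 by rewrite (le_lt_trans (ler_norm _))// ltrDl.
move=> /(_ MM) bK; exists (`|M| + 1) => [|x]; first by rewrite addr_ge0.
have [Kx|Kx] := pselect (K x); first by apply: bK; exists x.
by rewrite f0// normr0 addr_ge0.
Qed.

Lemma is_derive_line f x i (t : R) : derivable f (x + t *: e_ i) (e_ i) ->
  is_derive t 1 (fun r => f (x + r *: e_ i)) ('D_(e_ i) f (x + t *: e_ i)).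
Proof.
have q : (fun h : R => h^-1 *: (((fun r => f (x + r *: e_ i)) \o shift t) (h *: 1)
    - f (x + t *: e_ i))) =
  (fun h => h^-1 *: ((f \o shift (x + t *: e_ i)) (h *: e_ i) - f (x + t *: e_ i))).
  apply/funext => h /=; rewrite /shift/= [h *: 1]mulr1 scalerDl.
  by rewrite addrCA.
by move=> df; split; rewrite /derivable /derive q.
Qed.

Lemma mean_value_line f x i (h : R) : 0 < h -> (forall y, derivable f y (e_ i)) ->
  exists2 c, 0 < c < h & f (x + h *: e_ i) - f x = h * 'D_(e_ i) f (x + c *: e_ i).
Proof.
move=> h0 df; pose F r := f (x + r *: e_ i).
have dF (r : R) : is_derive r 1 F ('D_(e_ i) f (x + r *: e_ i)).
  exact: is_derive_line.
have [|c ch] := @MVT R F _ 0 h h0 (fun r _ => dF r).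
  by apply: derivable_within_continuous => r _; exact: (@ex_derive _ _ _ _ _ _ _ (dF r)).
by rewrite subr0 /F scale0r addr0 mulrC => Fh; exists c.
Qed.

(** The mean value theorem is applied twice: to [f] on [[0, h]], giving a point [c], then to its
    derivative on [[0, c]] with [c < h]. *)
Lemma taylor1_line f x i (C h : R) : 0 < h -> smooth f ->
  (forall y, `|'D_(e_ i) ('D_(e_ i) f) y| <= C) ->
  `|f (x + h *: e_ i) - f x - h * 'D_(e_ i) f x| <= C * h ^+ 2.
Proof.
move=> h0 sf fC.
have [c /andP[c0 ch] ->] := mean_value_line x h0 (fun y => smooth_derivable y i sf).
rewrite -mulrBr.
have [c' _ ->] := mean_value_line x c0 (fun y => smooth_derivable y i (smooth_derive i sf)).
rewrite !normrM (gtr0_norm h0) (gtr0_norm c0) mulrA mulrC.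
apply: ler_pM => //; first by rewrite mulr_ge0 ?ltW.
by rewrite expr2 ler_pM2l// ltW.
Qed.

End Smooth.

(** * Boundedness of coordinates in a finite-dimensional normed space *)

Section CoordBound.
Variables (R : realType) (E : finNormedModType R).

Lemma normr_entry n (c : 'rV[R]_n) j : `|c 0 j| <= `|c|.
Proof. by rewrite [leRHS]/Num.norm /= mx_normrE; apply/bigmax_geP; right; exists (0, j). Qed.

(* The coordinate map is bounded because c |-> |\sum_j c_j b_j| attains a
   positive minimum on the unit sphere of coordinates. *)
Lemma coord_bounded : exists2 C : R, 0 < C &
  forall (v : E) j, `|coord (vbasis {:E}) j v| <= C * `|v|.
Proof.
set n := \dim {:E}; set b := vbasis {:E}.
pose f (c : 'rV[R]_n) : E := \sum_j c 0 j *: b`_j.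
have cf : continuous (fun c => `|f c|).
  move=> c; apply: (@continuous_comp _ _ _ f (fun v : E => `|v|)); last first.
    exact: norm_continuous.
  apply: continuous_big => [|j _ y]; first exact: add_continuous.
  by apply: continuousZr_tmp; exact: coord_continuous.
pose c_ (v : E) : 'rV[R]_n := \row_j coord b j v.
have fc v : f (c_ v) = v.
  rewrite {2}(coord_vbasis (memvf v)); apply: eq_bigr => j _.
  by rewrite mxE.
have f0 c : f c = 0 -> c = 0.
  move=> fc0; apply/rowP => j; rewrite mxE.
  rewrite -(coord_sum_free (fun j => c 0 j) j (basis_free (vbasisP {:E}))).
  by rewrite -/(f c) fc0 linear0.
(* If the unit sphere is empty, every [c_ v] vanishes, since it could otherwise be normalised to a
   point of the sphere; any positive constant then works. *)
have [[c1 c1A]|A0] := pselect ([set c : 'rV[R]_n | `|c| = 1] !=set0); last first.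
  exists 1 => // v j; rewrite mul1r.
  suff c0 : c_ v = 0.
    by have := congr1 (fun c : 'rV[R]_n => c 0 j) c0; rewrite !mxE => ->; rewrite normr0.
  apply/eqP; apply: contra_notT A0 => c0.
  by exists (`|c_ v|^-1 *: c_ v); rewrite /= normrZ normfV normr_id mulVf// normr_eq0.
have [|||c0 /set_mem/= c0A minc0] := @EVT_min_rV R n (fun c => `|f c|) [set c | `|c| = 1].
- by exists c1.
- apply: bounded_closed_compact.
    by exists 1; split=> // M M1 c /= ->; exact: ltW.
  rewrite (_ : [set c | _] = (fun c : 'rV[R]_n => `|c|) @^-1` [set 1])//.
  by apply: preimage_closed; [move=> ? _; exact: norm_continuous|exact: closed_eq].
- exact: continuous_subspaceT.
have m0 : 0 < `|f c0|.
  rewrite normr_gt0; apply: contraPneq c0A => /f0 ->.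
  by rewrite normr0 => /eqP; rewrite eq_sym oner_eq0.
exists `|f c0|^-1 => [|v j]; first by rewrite invr_gt0.
have -> : coord b j v = c_ v 0 j by rewrite mxE.
apply: (le_trans (normr_entry _ _)); rewrite ler_pdivlMl//.
have [->|cv0] := eqVneq (c_ v) 0; first by rewrite normr0 mulr0.
have cvp : 0 < `|c_ v| by rewrite normr_gt0.
(* Minimality is used at the normalised coordinate vector, whose image under [f] is [v] divided by
   the norm of [c_ v]. *)
have /minc0 : `|c_ v|^-1 *: c_ v \in [set c | `|c| = 1].
  by rewrite inE /= normrZ normfV normr_id mulVf// gt_eqF.
rewrite (_ : f (_ *: _) = `|c_ v|^-1 *: v); last first.
  transitivity (`|c_ v|^-1 *: f (c_ v)); last by rewrite fc.
  rewrite /f scaler_sumr; apply: eq_bigr => i _.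
  by rewrite mxE scalerA.
by rewrite normrZ normfV normr_id ler_pdivlMl// mulrC.
Qed.

End CoordBound.

(** * Test forms: operations, comass estimate, and contraction *)

Section TestForms.
Variables (R : realType) (d : nat) (E : finNormedModType R).
Implicit Types (k : nat) (i : 'I_d).

Local Notation e_ i := (delta_mx 0 i : 'rV[R]_d).

Lemma kvector_norm_entry k (tau : kvector R d k) I : `|tau I| <= kvector_norm tau.
Proof.
rewrite -sqrtr_sqr ler_sqrt ?sumr_ge0// => [|J _]; last exact: sqr_ge0.
by rewrite (bigD1 I)//= lerDl sumr_ge0// => J _; exact: sqr_ge0.
Qed.

(** Expanding [tau] and [v] in bases turns estimates on finitely many scalar components into a
    comass estimate, with [B] independent of the covector. *)
Lemma covector_bounded_by_entries k : exists2 B : R, 0 < B &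
  forall (p : precovector d E k) (c : R), 0 <= c -> bilinear_for *:%R *:%R p ->
    (forall I (j : 'I_(\dim {:E})), `|p (kbasis R I) (vbasis {:E})`_j| <= c) ->
  forall tau v, kvector_norm tau <= 1 -> `|v| <= 1 -> `|p tau v| <= B * c.
Proof.
have [C C0 coordC] := coord_bounded E.
pose N : R := (#|{: multi_index d k}| * \dim {:E})%:R.
(* [N] counts the pairs of a multi-index and a basis vector; adding 1 keeps the constant positive
   when there are none. *)
exists (N * C + 1) => [|p c c0 bp pc tau v tau1 v1].
  by rewrite ltr_wpDl// mulr_ge0 ?ler0n// ltW.
apply: (@le_trans _ _ (N * C * c)); last by rewrite ler_wpM2r// lerDl.
rewrite covectorE//; apply: (le_trans (ler_norm_sum _ _ _)).
apply: (@le_trans _ _ (\sum_(I : multi_index d k) \sum_(j < \dim {:E}) C * c)).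
  apply: ler_sum => I _; rewrite normrM.
  have t1 : `|tau I| <= 1 by rewrite (le_trans (kvector_norm_entry _ _)).
  apply: (le_trans (ler_piMl (normr_ge0 _) t1)).
  rewrite [in leLHS](coord_vbasis (memvf v)) covector_sumr//.
  apply: (le_trans (ler_norm_sum _ _ _)); apply: ler_sum => j _.
  rewrite normrM ler_pM//; apply: (le_trans (coordC v j)).
  by rewrite ler_piMr// ltW.
by rewrite !sumr_const !card_ord -mulrnA mulnC -mulr_natl mulrA.
Qed.

Definition lin_form k (a : R) (w w' : Eform d E k) : Eform d E k :=
  fun x tau v => a * w x tau v + w' x tau v.

Definition zero_form k : Eform d E k := fun _ _ _ => 0.

Definition translate k (c : 'rV[R]_d) (w : Eform d E k) : Eform d E k :=
  fun x => w (x + c).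

(** The Lie derivative along the constant field [e_ i]: it differentiates the coefficients only. *)
Definition derive_form k i (w : Eform d E k) : Eform d E k :=
  fun x tau v => \sum_I tau I * 'D_(e_ i) (coef w I v) x.

Lemma test_form_zero k : test_form (@zero_form k).
Proof.
split=> [x|I v|]; [|exact: smooth0|by exists set0 => //; exact: compact0].
by split=> [v|tau] a ? ?; rewrite /zero_form /= scaler0 addr0.
Qed.

Lemma test_form_lin k a (w w' : Eform d E k) :
  test_form w -> test_form w' -> test_form (lin_form a w w').
Proof.
move=> [bw sw [K cK wK]] [bw' sw' [K' cK' wK']]; split=> [x|I v|].
- split=> [v|tau] b u u'; rewrite /lin_form /= ?covectorDl ?covectorDr//;
    rewrite -[b *: _]/(b * _); ring.
- exact: (@smooth_lin _ _ a (coef w I v) (coef w' I v)).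
- exists (K `|` K'); first exact: compactU.
  move=> x /not_orP[Kx K'x] tau v.
  by rewrite /lin_form wK// wK'// mulr0 addr0.
Qed.

Lemma test_form_translate k c (w : Eform d E k) :
  test_form w -> test_form (translate c w).
Proof.
move=> [bw sw [K cK wK]]; split=> [x|I v|]; first exact: bw.
  exact: (@smooth_translate _ _ (coef w I v)).
exists ((fun x => x - c) @` K).
  apply: continuous_compact => //; apply: continuous_subspaceT => x.
  apply: (@continuousD _ _ _ id (cst (- c))); first exact: cvg_id.
  exact: cst_continuous.
move=> x Kx tau v; rewrite /translate wK// => Kxc; apply: Kx.
by exists (x + c) => //; rewrite addrK.
Qed.

Lemma coef_linear k (w : Eform d E k) I (a : R) v v' : test_form w ->
  coef w I (a *: v + v') = fun y => a * coef w I v y + coef w I v' y.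
Proof.
by case=> bw _ _; apply/funext => y; rewrite /coef covectorDr.
Qed.

Lemma test_form_derive k i (w : Eform d E k) :
  test_form w -> test_form (derive_form i w).
Proof.
move=> tw; have [bw sw [K cK wK]] := tw; split=> [x|I v|].
- split=> [v|tau] b u u'; rewrite /derive_form /= scaler_sumr -big_split/=;
    apply: eq_bigr => I _; rewrite -[b *: (_ * _)]/(b * (_ * _)).
    by rewrite !ffunE -[b *: u I]/(b * u I); ring.
  by rewrite coef_linear// derive_lin; [ring|exact: smooth_derivable..].
- rewrite (_ : coef _ I v = 'D_(e_ i) (coef w I v)).
    exact: smooth_derive.
  apply/funext => x; rewrite /coef /derive_form (bigD1 I)//= big1 ?addr0.
    by rewrite ffunE eqxx mul1r.
  by move=> J JI; rewrite ffunE (negbTE JI) mul0r.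
- exists K => // x Kx tau v; rewrite /derive_form big1// => I _.
  rewrite (@derive_supported _ _ _ K) ?mulr0//.
    by apply: compact_closed => //; exact: norm_hausdorff.
  by move=> y Ky; rewrite /coef wK.
Qed.

Lemma kbasis_sum k (K : multi_index d k) (F : multi_index d k -> R) :
  \sum_J kbasis R K J * F J = F K.
Proof.
rewrite (bigD1 K)//= big1 ?addr0; first by rewrite ffunE eqxx mul1r.
by move=> J JK; rewrite ffunE (negbTE JK) mul0r.
Qed.

Section Contraction.
Variable (z : 'I_d) (z0 : (z : nat) = 0%N).

Lemma faceE k (J : multi_index d k.+1) r (i : 'I_k) : val (face J r) i = val J (lift r i).
Proof. by rewrite /= ffunE. Qed.

Lemma multi_index_eq k (J K : multi_index d k.+1) :
  val J ord0 = val K ord0 -> face J ord0 = face K ord0 -> J = K.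
Proof.
move=> JK0 JK; apply/val_inj/ffunP => i; have [j ->|->//] := unliftP ord0 i.
by rewrite -!faceE JK.
Qed.

(* e_z /\ sigma: as z is the least index, no sign occurs. *)
Definition prepend k (sigma : kvector R d k) : kvector R d k.+1 :=
  [ffun J : multi_index d k.+1 => if val J ord0 == z then sigma (face J ord0) else 0].

Lemma prepend_face k (J : multi_index d k.+1) :
  val J ord0 = z -> prepend (kbasis R (face J ord0)) = kbasis R J.
Proof.
move=> Jz; apply/ffunP => K; rewrite !ffunE.
have [Kz|Kz] := eqVneq (val K ord0) z; last first.
  by have [KJ|//] := eqVneq K J; rewrite KJ Jz eqxx in Kz.
congr (_%:R); congr nat_of_bool; apply/eqP/eqP => [|->//].
by apply: multi_index_eq; rewrite Kz.
Qed.

(** A multi-index starting with [z] whose remainder is [I] would contain [z] twice, against strict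
    increase. *)
Lemma prepend_kbasis0 k (I : multi_index d k) (i : 'I_k) :
  val I i = z -> prepend (kbasis R I) = 0.
Proof.
move=> Iz; apply/ffunP => K; rewrite !ffunE; case: eqP => // Kz.
case: eqP => // KI; have /'forall_forallP/(_ ord0 (lift ord0 i)) := valP K.
by rewrite -faceE KI Iz Kz ltnn.
Qed.

(** The interior product with the constant field [e_z], dual to [prepend]. *)
Definition contract k (w : Eform d E k.+1) : Eform d E k :=
  fun x sigma v => w x (prepend sigma) v.

Lemma test_form_contract k (w : Eform d E k.+1) :
  test_form w -> test_form (contract w).
Proof.
move=> [bw sw [K cK wK]]; split=> [x|I v|].
- split=> [v|tau] b u u'; rewrite /contract; last by rewrite covectorDr.
  rewrite (_ : prepend _ = b *: prepend u + prepend u') ?covectorDl//.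
  apply/ffunP => J; rewrite !ffunE; case: ifP => // _.
  by rewrite scaler0 addr0.
- rewrite (_ : coef _ I v =
    fun x => \sum_(J : multi_index d k.+1) prepend (kbasis R I) J * coef w J v x).
    exact: smooth_sum.
  by apply/funext => x; rewrite /coef /contract covectorE.
- by exists K => // x Kx tau v; rewrite /contract wK.
Qed.

(** As [z] is the index 0, a first entry other than [z] makes all entries of [J] positive, so [z]
    can be put in front. *)
Lemma multi_index_cons k (J : multi_index d k.+1) : val J ord0 != z ->
  exists2 K : multi_index d k.+2, val K ord0 = z & face K ord0 = J.
Proof.
move=> J0; pose f : {ffun 'I_k.+2 -> 'I_d} :=
  [ffun i => if unlift ord0 i is Some j then val J j else z].
have Jpos j : (0 < val J j)%N.
  have J0pos : (0 < val J ord0)%N.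
    by rewrite lt0n; apply: contra J0 => /eqP J00; apply/eqP/val_inj; rewrite /= J00 z0.
  have [j0|jpos] := posnP j; first by rewrite (_ : j = ord0)//; exact: val_inj.
  by have /'forall_forallP/(_ ord0 j)/implyP/(_ jpos) := valP J; exact: leq_trans.
have incf : increasing f.
  apply/'forall_forallP => i j; apply/implyP; rewrite !ffunE.
  have [j' ->|->//] := unliftP ord0 j; have [i' -> ij|-> _] := unliftP ord0 i.
    have /'forall_forallP/(_ i' j')/implyP := valP J; apply.
    by move: ij; rewrite !lift0 ltnS.
  by rewrite z0.
exists (Sub f incf); first by rewrite /= ffunE unlift_none.
by apply/val_inj/ffunP => i; rewrite faceE /= ffunE liftK.
Qed.

Lemma face_lift_face k (K : multi_index d k.+2) r :
  face (face K (lift ord0 r)) ord0 = face (face K ord0) r.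
Proof.
apply/val_inj/ffunP => i; rewrite !faceE; congr (val K _); apply: val_inj.
by rewrite /= /bump /=; lia.
Qed.

(* Cartan's formula for the constant field e_z and a closed form. *)
Lemma ext_d_contract k (w : Eform d E k.+1) : test_form w ->
  (forall x sigma v, ext_d w x sigma v = 0) ->
  ext_d (contract w) = derive_form z w.
Proof.
move=> [bw sw _] dw0; apply/funext => x; apply/funext => tau; apply/funext => v.
apply: eq_bigr => J _; congr (_ * _).
have coefz (I : multi_index d k.+1) : val I ord0 = z ->
    coef (contract w) (face I ord0) v = coef w I v.
  by move=> Iz; apply/funext => y; rewrite /coef /contract prepend_face.
have [Jz|Jz] := eqVneq (val J ord0) z.
  (* When [J] starts with [z], only the face without [z] contributes; the other faces still contain
     [z], so [prepend] kills them. *)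
  rewrite big_ord_recl expr0 mul1r Jz coefz// big1 ?addr0// => r _.
  rewrite (_ : coef _ _ v = cst 0) ?derive_cst ?mulr0//.
  apply/funext => y; rewrite /coef /contract.
  (* The position of [z] in this face is 0, an element of ['I_k] because [r] shows that [k] is
     positive. *)
  rewrite (@prepend_kbasis0 _ _ (Ordinal (leq_ltn_trans (leq0n r) (ltn_ord r)))).
    by rewrite covectorE// big1// => I _; rewrite ffunE mul0r.
  by rewrite faceE -Jz; congr (val J _); exact: val_inj.
(* Otherwise closedness is read on [K], which is [z] followed by [J]: its leading term is the
   [z]-derivative of the coefficient on [J], and the others form minus the sum sought. *)
have [K Kz KJ] := multi_index_cons Jz.
have := dw0 x (kbasis R K) v; rewrite /ext_d kbasis_sum big_ord_recl expr0 mul1r.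
rewrite KJ Kz => /eqP; rewrite addr_eq0 => /eqP ->; rewrite -sumrN.
apply: eq_bigr => r _; rewrite lift0 exprS mulN1r mulNr opprK -faceE KJ.
by rewrite -coefz ?face_lift_face ?KJ// faceE -Kz; congr (val K _); exact: val_inj.
Qed.

(** In degree 0 the coefficient of the differential on the one-entry index [z] is the [z]-derivative
    itself. *)
Lemma closed_0form_derive (w : Eform d E 0) :
  (forall x sigma v, ext_d w x sigma v = 0) -> derive_form z w = @zero_form 0.
Proof.
move=> dw0; apply/funext => x; apply/funext => tau; apply/funext => v.
rewrite /derive_form big1// => I _.
have incz : increasing ([ffun=> z] : {ffun 'I_1 -> 'I_d}).
  by apply/'forall_forallP => i j; rewrite !ord1.
pose J : multi_index d 1 := Sub [ffun=> z] incz.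
have := dw0 x (kbasis R J) v; rewrite /ext_d kbasis_sum big_ord_recl big_ord0.
rewrite expr0 mul1r addr0 (_ : face J ord0 = I) ?[val J ord0]ffunE.
  by move=> ->; rewrite mulr0.
by apply/val_inj/ffunP => -[].
Qed.

End Contraction.
End TestForms.

(** * Functionals bounded by the comass that vanish on [derive_form z w] for closed [w] *)

Section ClosedForms.
Variables (R : realType) (d k : nat) (E : finNormedModType R).
Variables (z : 'I_d) (S : functional d E k) (M : R).
Implicit Types w : Eform d E k.

Local Notation e := (delta_mx 0 z : 'rV[R]_d).

Hypothesis S_lin : forall a w w', test_form w -> test_form w' ->
  S (lin_form a w w') = a * S w + S w'.
Hypothesis S_comass : forall w, test_form w -> (comass w <= 1)%E -> S w <= M.
Hypothesis S_derive : forall w, test_form w ->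
  (forall x sigma v, ext_d w x sigma v = 0) -> S (derive_form z w) = 0.

Let S0 : S (@zero_form R d E k) = 0.
Proof.
have t0 := @test_form_zero R d E k.
have := S_lin (-1) t0 t0; rewrite mulN1r addNr => <-; congr S.
by apply/funext => x; apply/funext => tau; apply/funext => v; rewrite /lin_form mulr0 addr0.
Qed.

Let M_ge0 : 0 <= M.
Proof.
rewrite -S0 S_comass//; first exact: test_form_zero.
by apply/comassP => x; apply: covector_comass_le.
Qed.

(** Dividing [w] by [c] and by [-c] gives comass at most 1, and the one-sided bound [S_comass] for
    both signs controls the absolute value. *)
Lemma functional_le w (c : R) : 0 < c -> test_form w ->
  (forall x tau v, kvector_norm tau <= 1 -> `|v| <= 1 -> `|w x tau v| <= c) ->
  `|S w| <= M * c.
Proof.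
move=> c0 tw wc.
have le b : `|b| = c^-1 -> b * S w <= M.
  move=> bc; have tb := test_form_lin b tw (@test_form_zero R d E k).
  rewrite -[leLHS]addr0 -S0 -S_lin//; last exact: test_form_zero.
  apply: S_comass => //; apply/comassP => x.
  apply: covector_comass_le => tau v _ t1 v1.
  rewrite /lin_form /zero_form addr0 (le_trans (ler_norm _))// normrM bc.
  by rewrite ler_pdivrMl// mulr1 wc.
have /(_ c^-1) := le; have /(_ (- c^-1)) := le.
rewrite normrN gtr0_norm ?invr_gt0// => /(_ erefl) + /(_ erefl).
rewrite mulNr -mulrN !ler_pdivrMl// ler_norml lerNl (mulrC M) => -> ->.
by [].
Qed.

Lemma ext_d_translate w c x sigma v :
  ext_d (translate c w) x sigma v = ext_d w (x + c) sigma v.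
Proof.
apply: eq_bigr => J _; congr (_ * _); apply: eq_bigr => r _; congr (_ * _).
exact: (derive_translate (coef w (face J r) v)).
Qed.

Lemma second_derivative_bounded w : test_form w ->
  exists2 C : R, 0 < C & forall c I (j : 'I_(\dim {:E})) y,
    `|'D_e ('D_e (coef (translate c w) I (vbasis {:E})`_j)) y| <= C.
Proof.
move=> [bw sw [K cK wK]].
have bd (p : multi_index d k * 'I_(\dim {:E})) : exists C : R,
    0 <= C /\ forall y, `|'D_e ('D_e (coef w p.1 (vbasis {:E})`_p.2)) y| <= C.
  have clK : closed K by apply: compact_closed => //; exact: norm_hausdorff.
  have [|y Ky|C C0 hC] := @continuous_compact_support_bounded _ _
      ('D_e ('D_e (coef w p.1 (vbasis {:E})`_p.2))) K cK.
  - exact: (sw _ _ [:: z; z]).1.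
  - apply: (derive_supported _ clK) Ky => y' Ky'.
    by apply: (derive_supported _ clK) Ky' => y'' Ky''; rewrite /coef wK.
  - by exists C.
have [C hC] := choice bd.
(* The sum dominates the bound of each component, and the extra 1 gives the strict positivity that
   [functional_le] later demands. Translating by [c] does not change a bound valid at all points. *)
exists (\sum_p C p + 1).
  by rewrite ltr_wpDl// sumr_ge0// => p _; case: (hC p).
move=> c I j y.
have -> : 'D_e ('D_e (coef (translate c w) I (vbasis {:E})`_j)) y =
    'D_e ('D_e (coef w I (vbasis {:E})`_j)) (y + c).
  rewrite -derive_translate; congr ('D_e _ y); apply/funext => y'.
  exact: (derive_translate (coef w I (vbasis {:E})`_j)).
have [_ /(_ (y + c)) /= /le_trans] := hC (I, j); apply.
rewrite (bigD1 (I, j))//= -addrA lerDl addr_ge0// sumr_ge0// => p _.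
by case: (hC p).
Qed.

(* Taylor's formula along e bounds the comass of w(. + h e) - w - h D_e w. *)
Lemma functional_small_translate w : test_form w ->
  (forall x sigma v, ext_d w x sigma v = 0) ->
  exists2 C : R, 0 <= C & forall c (h : R), 0 < h ->
    `|S (translate (c + h *: e) w) - S (translate c w)| <= C * h ^+ 2.
Proof.
move=> tw dw0; have [C C0 hC] := second_derivative_bounded tw.
have [B B0 hB] := covector_bounded_by_entries d E k.
exists (M * (B * C)) => [|c h h0]; first by rewrite !mulr_ge0// ltW.
pose u := translate c w; have tu : test_form u by exact: test_form_translate.
have du0 x sigma v : ext_d u x sigma v = 0 by rewrite ext_d_translate.
pose uh := translate (c + h *: e) w.
have tuh : test_form uh by exact: test_form_translate.
have tdu := test_form_derive z tu.
have tl := test_form_lin (-1) tu tuh.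
(* [u] is closed, so [S] vanishes on its derivative, and subtracting the first-order term leaves the
   value unchanged. *)
have -> : S uh - S u = S (lin_form (- h) (derive_form z u) (lin_form (-1) u uh)).
  by rewrite !S_lin// S_derive//; ring.
rewrite -!mulrA; apply: functional_le.
- by rewrite !mulr_gt0// exprn_gt0.
- exact: test_form_lin.
move=> x tau v tau1 v1; apply: hB => //.
- by rewrite mulr_ge0 ?ltW// exprn_gt0.
- by case: (test_form_lin (- h) tdu tl).
move=> I j; set b := _`_j.
have := @taylor1_line _ _ (coef u I b) x z C h h0 (test_form_smooth tu I b) (hC c I j).
apply: le_trans; rewrite le_eqVlt; apply/orP; left; apply/eqP; congr (`|_|).
rewrite /lin_form /derive_form kbasis_sum /coef /u /uh /translate.
by rewrite (_ : x + h *: e + c = x + (c + h *: e)) 1?addrAC ?addrA//; ring.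
Qed.

(** Cutting the shift into [n] steps of length [t / n] costs at most [C t^2 / n] in total, which
    tends to 0. *)
Lemma functional_translate w (t : R) : 0 < t -> test_form w ->
  (forall x sigma v, ext_d w x sigma v = 0) ->
  S (translate (t *: e) w) = S w.
Proof.
move=> t0 tw dw0; have [C C0 hC] := functional_small_translate tw dw0.
have w0 : translate 0 w = w by apply/funext => x; rewrite /translate addr0.
have step (h : R) n : 0 < h ->
    `|S (translate ((n%:R * h) *: e) w) - S w| <= n%:R * (C * h ^+ 2).
  move=> h0; elim: n => [|n IH].
    by rewrite !mul0r scale0r w0 subrr normr0.
  rewrite (_ : _ *: e = (n%:R * h) *: e + h *: e); last first.
    by rewrite -natr1 mulrDl mul1r scalerDl.
  rewrite -natr1 mulrDl mul1r [leRHS]addrC.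
  apply: le_trans (lerD (hC ((n%:R * h) *: e) h h0) IH).
  by apply: le_trans (ler_normD _ _); rewrite addrA subrK.
apply/eqP; rewrite -subr_eq0 -normr_le0; apply/ler_addgt0Pr => eps eps0.
rewrite add0r; set K := C * t ^+ 2.
have K0 : 0 <= K by rewrite mulr_ge0// exprn_ge0// ltW.
have := archi_boundP (divr_ge0 K0 (ltW eps0)).
set n := Num.bound _ => Kn.
have n0 : 0 < n%:R :> R by apply: le_lt_trans Kn; rewrite divr_ge0// ltW.
have := step (t / n%:R) n (divr_gt0 t0 n0); rewrite mulrCA divff ?gt_eqF// mulr1.
move=> /le_trans; apply.
have -> : n%:R * (C * (t / n%:R) ^+ 2) = K / n%:R.
  by rewrite /K; field; rewrite gt_eqF.
by rewrite ler_pdivrMr// mulrC -ler_pdivrMr// ltW.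
Qed.

(* Sums of n disjoint translates of w have the comass of w, and S is additive
   on them, so n |S w| stays bounded. *)
Lemma functional_closed_le0 w : test_form w ->
  (forall x sigma v, ext_d w x sigma v = 0) -> (comass w <= 1)%E -> S w <= 0.
Proof.
move=> tw dw0 /comassP w1; have [bw _ [K cK wK]] := tw.
have [L L0 hL] : exists2 L : R, 0 < L & forall x (i j : nat),
    K (x + (i%:R * L) *: e) -> K (x + (j%:R * L) *: e) -> i = j.
  have [N [_ /(_ (`|N| + 1))]] := compact_bounded cK.
  have NN : N < `|N| + 1 by rewrite (le_lt_trans (ler_norm _))// ltrDl.
  move=> /(_ NN) bK; set N1 := `|N| + 1 in bK NN *.
  have N10 : 0 < N1 by rewrite ltr_wpDl.
  (* Points of [K] have [z]-coordinate between [-N1] and [N1], so a shift of length [2 * N1 + 1]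
     along [e] always leaves [K]. *)
  exists (2 * N1 + 1) => [|x i j]; first lra.
  wlog ij : i j / (i <= j)%N.
    move=> H Ki Kj; have [|/ltnW] := leqP i j; first by move=> ij; exact: H.
    by move=> ij; apply/esym; exact: H.
  move=> /bK /= bi /bK /= bj; apply/eqP; rewrite eqn_leq ij /= leqNgt.
  apply/negP => lij.
  have := le_trans (normr_entry _ z) bi; have := le_trans (normr_entry _ z) bj.
  rewrite !mxE !eqxx !mulr1 !ler_norml => /andP[_ h1] /andP[h2 _].
  have : i%:R + 1 <= j%:R :> R by rewrite natr1 ler_nat.
  by nra.
pose U := fix U n : Eform d E k := if n is n'.+1 then
  lin_form 1 (translate ((n'%:R * L) *: e) w) (U n') else @zero_form R d E k.
have tU n : test_form (U n).
  elim: n => [|n IH] /=; first exact: test_form_zero.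
  by apply: test_form_lin => //; exact: test_form_translate.
have SU n : S (U n) = n%:R * S w.
  elim: n => [|n IH]; first by rewrite S0 mul0r.
  rewrite [U _]/= S_lin ?IH//; last exact: test_form_translate.
  (* Invariance is stated for positive shifts; the term of index 0 is [w] itself. *)
  rewrite -natr1; have [->|n0] := posnP n; last first.
    by rewrite functional_translate//; [ring|rewrite mulr_gt0// ltr0n].
  rewrite (_ : translate _ w = w); first ring.
  by apply/funext => x; rewrite /translate mul0r scale0r addr0.
have U0 n x tau v : (forall i, (i < n)%N -> ~ K (x + (i%:R * L) *: e)) -> U n x tau v = 0.
  elim: n => [//|n IH] nK /=; rewrite /lin_form IH; last by move=> i /ltnW; exact: nK.
  by rewrite /translate wK ?mulr0 ?addr0//; exact: nK.
have U1 n : (comass (U n) <= 1)%E.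
  apply/comassP => x; apply: covector_comass_le => tau v st t1 v1.
  elim: n => [|n IH]; first by rewrite ler01.
  (* At a given point, either the last translate is the only one that can be nonzero, or it vanishes
     and induction applies. *)
  rewrite /= /lin_form mul1r; have [Kn|nKn] := pselect (K (x + (n%:R * L) *: e)).
    rewrite U0 ?addr0.
      rewrite (le_trans (ler_norm _))// (le_trans _ v1)//.
      exact: (covector_le_norm (bw _) v (w1 _) st t1).
    by move=> i lin Ki; move: lin; rewrite (hL _ _ _ Ki Kn) ltnn.
  by rewrite /translate wK// add0r.
rewrite leNgt; apply/negP => Sw0.
(* Some [n] exceeds [M / S w], so that [S (U n) = n * S w] would exceed [M]. *)
have := archi_boundP (divr_ge0 M_ge0 (ltW Sw0)).
rewrite ltr_pdivrMr// -SU ltNge => /negP; apply.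
exact: S_comass.
Qed.

End ClosedForms.

(** * Mass bounds, equal boundaries, and minimality *)

Section Currents.
Variables (R : realType) (d k : nat) (E : finNormedModType R).
Implicit Types (T : functional d E k) (w : Eform d E k).

Lemma current0 T : current T -> T (@zero_form R d E k) = 0.
Proof.
case=> linT _; have t0 := @test_form_zero R d E k.
have := linT (-1) _ _ t0 t0; rewrite mulN1r addNr => <-; congr T.
apply/funext => x; apply/funext => tau; apply/funext => v.
by rewrite /zero_form mulr0 addr0.
Qed.

Lemma le_mass T w : test_form w -> (comass w <= 1)%E -> ((T w)%:E <= mass T)%E.
Proof. by move=> tw w1; apply: ereal_sup_ubound; exists w. Qed.

(** The opposite form has the same comass bound and is an admissible competitor in the supremum. *)
Lemma opp_le_mass T w : current T -> test_form w -> (comass w <= 1)%E ->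
  ((- T w)%:E <= mass T)%E.
Proof.
move=> cT tw w1; have t0 := @test_form_zero R d E k.
rewrite (_ : - T w = T (lin_form (-1) w (@zero_form R d E k))); last first.
  by rewrite (current_linear cT)// current0// mulN1r addr0.
apply: le_mass; first exact: test_form_lin.
apply/comassP => x; apply: covector_comass_le => tau v st t1 v1.
rewrite /lin_form /zero_form addr0 mulN1r (le_trans (ler_norm _))// normrN.
move/comassP: w1 => w1.
by rewrite (le_trans _ v1)// (covector_le_norm (test_form_bilinear tw x)).
Qed.

End Currents.

(** In positive degree the derivative is the differential of the test form [contract z w], on which
    the boundaries agree. In degree 0 it is the zero form. *)
Lemma boundary_eq_derive (R : realType) (d k : nat) (E : finNormedModType R)
    (T T' : functional d E k) (z : 'I_d) (w : Eform d E k) : z = 0%N :> nat ->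
  current T -> current T' -> eq_current (boundary T') (boundary T) ->
  test_form w -> (forall x sigma v, ext_d w x sigma v = 0) ->
  T (derive_form z w) = T' (derive_form z w).
Proof.
move=> z0 cT cT' TT' tw dw0; case: k T T' w cT cT' TT' tw dw0 => [|k'] T T' w.
  by move=> cT cT' _ _ dw0; rewrite closed_0form_derive// (current0 cT) (current0 cT').
move=> _ _ TT' tw dw0; rewrite -ext_d_contract//; apply/esym.
exact: (TT' _ (test_form_contract z tw)).
Qed.

Theorem proposition3p2 (R : realType) (d k : nat) (hd : (0 < d)%N)
    (E : finNormedModType R) (G : set E) (hG : discrete_subgroup G)
    (T : functional d E k) (Sigma : set 'rV[R]_d)
    (tau : 'rV[R]_d -> kvector R d k) (theta : 'rV[R]_d -> E)
    (hT : rectifiable_G_current G T Sigma tau theta)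
    (omega : Eform d E k) (homega : smooth_calibration Sigma tau theta omega)
    (T' : functional d E k) (hT' : normal_current T')
    (hbd : eq_current (boundary T') (boundary T)) :
  (mass T <= mass T')%E.
Proof.
have [cT rT _ _] := hT; have [cT' _] := hT'.
have [tomega _ domega0 omega1] := homega.
have massT : (mass T <= (T omega)%:E)%E.
  apply: ge_ereal_sup => _ [w [tw w1] <-].
  by rewrite lee_fin (calibrated_eq_norm rT homega) (rectifiable_le_norm rT).
have [->|mT'] := eqVneq (mass T') +oo%E; first exact: leey.
have mT'fin : mass T' \is a fin_num.
  rewrite fin_numE mT' andbT -ltNye; apply: lt_le_trans (le_mass T' tomega omega1).
  exact: ltNyr.
apply: (le_trans massT); apply: le_trans (le_mass T' tomega omega1).
rewrite lee_fin -subr_le0.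
pose S : functional d E k := fun w => T w - T' w.
(* The direction of translation is coordinate 0, as contraction requires. The bound on [S] adds the
   two masses, with [T omega] bounding that of [T]. *)
apply: (@functional_closed_le0 R d k E (Ordinal hd) S (T omega + fine (mass T'))) => //.
- move=> a w w' tw tw'; rewrite /S (current_linear cT)// (current_linear cT')//.
  ring.
- move=> w tw w1; apply: lerD.
    by rewrite -lee_fin (le_trans _ massT)// le_mass.
  by rewrite -lee_fin fineK// opp_le_mass.
- move=> w tw dw0; apply/eqP; rewrite subr_eq0; apply/eqP.
  exact: boundary_eq_derive.
Qed.
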